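(* Let $m,k$ be integers with $1\le m$, $k\le N-1$, $k-m>1$, such that $$\phi^{m-1}-\phi^m>\phi^m-\phi^{m+1}=\cdots=\phi^{k-1}-\phi^k>\phi^k-\phi^{k+1},$$ and suppose there exist a labeled atom ${\tt Z}\in\aleph_k^\bullet$ and forests $F,G\in\tilde{\cal F}^{k-1}$ with ${\tt N}^{out}_{\tt Z}(F)\neq\emptyset$ and ${\tt N}^{out}_{\tt Z}(G)=\emptyset$. Then ${\tt N}^{out}_{\tt Z}(\tilde{\cal F}^m)\neq\emptyset$ (the union of ${\tt N}^{out}_{\tt Z}(H)$ over $H\in\tilde{\cal F}^m$ is nonempty), and: 1) there exists a forest $H\in\tilde{\cal F}^m$ with ${\tt N}^{out}_{\tt Z}(H)\neq\emptyset$ and $H|_{\uparrow{\tt Z}}\in\tilde{\cal T}^\circ_{\tt Z}$; in particular, if ${\tt N}^{out}_{\tt Z}(H)\neq\emptyset$ for all $H\in\tilde{\cal F}^m$, then $H|_{\uparrow{\tt Z}}\in\tilde{\cal T}^\circ_{\tt Z}$ for all $H\in\tilde{\cal F}^m$; 2) if there exists a forest $S\in\tilde{\cal F}^m$ with ${\tt N}^{out}_{\tt Z}(S)=\emptyset$, then $S|_{\tt Z}\in\tilde{\cal T}^\bullet_{\tt Z}$, and in this case for every $T\in\tilde{\cal T}^\bullet_{\tt Z}$ there exists $Q\in\tilde{\cal F}^m$ with $Q|_{\uparrow{\tt Z}}=Q|_{\tt Z}=T$.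
   Context: $V$ is a directed graph without loops on a finite vertex set ${\tt N}$, $|{\tt N}|=N$; each arc $(i,j)$ has a real weight $v_{ij}$; $V$ is assumed to have at least one spanning tree. An (entering) forest is a directed graph in which at most one arc leaves each vertex and there are no directed cycles; its components are trees, the root of a tree being its unique vertex with no outgoing arc. All forests and trees are subgraphs of $V$. For a subgraph $G$ and ${\tt D}\subseteq{\tt N}$, $\Upsilon^G_{\tt D}=\sum_{i\in{\tt D},(i,j)\in G}v_{ij}$ (heads may lie outside ${\tt D}$), $\Upsilon^G=\Upsilon^G_{\tt N}$. ${\cal F}^j$: spanning forests of $V$ with exactly $j$ trees; $\phi^j=\min_{F\in{\cal F}^j}\Upsilon^F$ ($\phi^j=\infty$ if ${\cal F}^j=\emptyset$; $\phi^0=\infty$); $\tilde{\cal F}^j$: forests in ${\cal F}^j$ of weight $\phi^j$. $\mathfrak{A}_k$: algebra of subsets of ${\tt N}$ generated by the vertex sets of all trees of all forests in $\tilde{\cal F}^k$; $\aleph_k$: its atoms (nonempty elements ${\tt A}$ with ${\tt A}\cap{\tt B}\in\{\emptyset,{\tt A}\}$ for all ${\tt B}\in\mathfrak{A}_k$); $\aleph_k^\bullet$: labeled atoms (containing a root of some tree of some $F\in\tilde{\cal F}^k$). For ${\tt D}\subseteq{\tt N}$: ${\cal T}^\bullet_{\tt D}$ is the set of trees with vertex set ${\tt D}$, $\lambda^\bullet_{\tt D}=\min_{T\in{\cal T}^\bullet_{\tt D}}\Upsilon^T$, $\tilde{\cal T}^\bullet_{\tt D}=\{T\in{\cal T}^\bullet_{\tt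 D}:\Upsilon^T=\lambda^\bullet_{\tt D}\}$; ${\cal T}^\circ_{\tt D}$ is the set of trees $T$ with $|{\tt V}T|=|{\tt D}|+1$, ${\tt D}\subset{\tt V}T$, and $T|_{\tt D}\in{\cal T}^\bullet_{\tt D}$; $\lambda^\circ_{\tt D}=\min_{T\in{\cal T}^\circ_{\tt D}}\Upsilon^T$, $\tilde{\cal T}^\circ_{\tt D}=\{T\in{\cal T}^\circ_{\tt D}:\Upsilon^T=\lambda^\circ_{\tt D}\}$. $G|_{\tt D}$ is the induced subgraph on ${\tt D}$. ${\tt N}^{out}_{\tt D}(G)$ is the set of heads $j\notin{\tt D}$ of arcs $(i,j)\in G$ with $i\in{\tt D}$. The outgoing restriction $G|_{\uparrow{\tt D}}$ has as arcs exactly the arcs of $G$ with tail in ${\tt D}$ and vertex set ${\tt D}\cup{\tt N}^{out}_{\tt D}(G)$.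
   Formalization: The class T°_D is restricted to trees whose root is the extra vertex outside D; without this, a cheap arc from the extra vertex into D (as w→z1 with Z={z1}) makes part 1 false. *)

(* Defs.v *)
From mathcomp Require Import all_boot all_order all_algebra.
From mathcomp Require Import constructive_ereal.

Set Implicit Arguments.
Unset Strict Implicit.
Unset Printing Implicit Defensive.

Import Order.TTheory GRing.Theory Num.Theory.
Local Open Scope ring_scope.

(* A directed graph is a pair (vertex set, arc set); nothing forces the ends  *)
(* of the arcs to be vertices, this is part of [subgraph] below.              *)
Notation digraph N := ({set N} * {set N * N})%type.

Section Digraphs.
Variable N : finType.
Implicit Types (G F H S : digraph N) (D : {set N}).

Definition vset G : {set N} := G.1.
Definition arcs G : {set N * N} := G.2.

Definition has_arc G : rel N := [rel x y | (x, y) \in arcs G].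
Definition adj G : rel N := [rel x y | has_arc G x y || has_arc G y x].

Definition subgraph (G V : digraph N) : bool :=
  [&& vset G \subset vset V, arcs G \subset arcs V &
      arcs G \subset setX (vset G) (vset G)].

(* The vertices of a directed cycle are distinct, so cycles of length at most *)
(* #|N| exhaust them, see [acyclicP].                                         *)
Definition acyclic G : bool :=
  [forall l : 'I_#|N|, forall c : l.+1.-tuple N, ~~ ucycleb (has_arc G) c].

Lemma acyclicP G :
  reflect (forall c : seq N, ucycle (has_arc G) c -> c = [::]) (acyclic G).
Proof.
apply: (iffP idP) => [/forallP acG [//|x c] cycG | acG].
  have lt_c : (size c < #|N|)%N.
    by case/andP: cycG => _ /card_uniqP => /= <-; apply: max_card.
  by have /forallP/(_ (in_tuple (x :: c)))/negP := acG (Ordinal lt_c).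
apply/forallP => l; apply/forallP => c; apply/negP => /acG c0.
by have := size_tuple c; rewrite c0.
Qed.

Definition is_forest G : bool :=
  acyclic G && [forall x, #|[set y | has_arc G x y]| <= 1]%N.

Definition induced G D : digraph N :=
  (vset G :&: D, [set a in arcs G | (a.1 \in D) && (a.2 \in D)]).

(* Weakly connected components, as graphs. *)
Definition components G : {set digraph N} :=
  [set induced G C | C in equivalence_partition (connect (adj G)) (vset G)].

Definition is_tree G : bool := is_forest G && (#|components G| == 1)%N.

Definition is_root G (x : N) : bool :=
  (x \in vset G) && [forall y, ~~ has_arc G x y].

Definition Nout D G : {set N} :=
  [set j | (j \notin D) && [exists i in D, has_arc G i j]].

Definition outres G D : digraph N :=
  (D :|: Nout D G, [set a in arcs G | a.1 \in D]).

Definition set_algebra (A : {set {set N}}) : bool :=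
  [&& setT \in A, [forall B in A, ~: B \in A] &
      [forall B in A, forall C in A, B :|: C \in A]].

Definition gen_algebra (S : {set {set N}}) : {set {set N}} :=
  \bigcap_(A : {set {set N}} | set_algebra A && (S \subset A)) A.

Definition atoms (A : {set {set N}}) : {set {set N}} :=
  [set B in A | (B != set0) &&
     [forall C in A, (B :&: C == set0) || (B :&: C == B)]].

End Digraphs.

Section Weights.
Variables (R : realFieldType) (N : finType) (V : digraph N) (v : N * N -> R).

Definition weight_in (D : {set N}) (G : digraph N) : R :=
  \sum_(a in arcs G | a.1 \in D) v a.

Definition weight (G : digraph N) : R := weight_in setT G.

(* The minimum over the empty family is +oo. *)
Definition min_weight (S : {set digraph N}) : \bar R :=
  \big[Order.min/+oo%E]_(G in S) (weight G)%:E.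

Definition minimizers (S : {set digraph N}) : {set digraph N} :=
  [set G in S | (weight G)%:E == min_weight S].

Definition forests (j : nat) : {set digraph N} :=
  [set F | [&& subgraph F V, vset F == [set: N], is_forest F &
               #|components F| == j]].

Definition phi (j : nat) : \bar R := min_weight (forests j).

Definition min_forests (j : nat) : {set digraph N} := minimizers (forests j).

Definition forest_algebra (k : nat) : {set {set N}} :=
  gen_algebra (\bigcup_(F in min_forests k) [set vset T | T in components F]).

Definition forest_atoms (k : nat) : {set {set N}} := atoms (forest_algebra k).

Definition labeled_atoms (k : nat) : {set {set N}} :=
  [set Z in forest_atoms k |
     [exists F in min_forests k, exists T in components F, exists x in Z,
        is_root T x]].

Definition trees_in (D : {set N}) : {set digraph N} :=
  [set T | [&& subgraph T V, is_tree T & vset T == D]].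

Definition min_trees_in (D : {set N}) : {set digraph N} :=
  minimizers (trees_in D).

(* Trees obtained from a tree on D by adding one vertex outside D, which is   *)
(* the root: the arc joining it to D leaves D. Trees whose additional vertex  *)
(* sends an arc into D, and whose root is thus in D, are not included.        *)
Definition trees_out (D : {set N}) : {set digraph N} :=
  [set T | [&& subgraph T V, is_tree T, #|vset T| == #|D|.+1,
               D \subset vset T, induced T D \in trees_in D &
               [forall x in D, ~~ is_root T x]]].

Definition min_trees_out (D : {set N}) : {set digraph N} :=
  minimizers (trees_out D).

End Weights.

(* Main.v *)
Require Import Defs.
From mathcomp Require Import all_boot all_order all_algebra.
From mathcomp Require Import constructive_ereal.
From mathcomp Require Import zify ring lra.

Import Order.TTheory GRing.Theory Num.Theory.
Local Open Scope ring_scope.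

Set Implicit Arguments.
Unset Strict Implicit.

(* A spanning forest is encoded by its parent map f : N -> N, roots being the *)
(* fixed points, so that splicing two forests along D is a case distinction.  *)
(* Charge lam = phi^{k-1} - phi^k for each root: exchanging along the tree of *)
(* one forest that avoids the roots of another shows that the optimal maps    *)
(* for the charged cost are exactly the minimal forests with m to k trees, so *)
(* optimality is kept by any splice whose complementary splice is acyclic.    *)
(* The labeled atom Z is then precisely a tree of some K minimal with k trees.*)
(* Since K has no arc entering or leaving Z, any optimal E may be plugged     *)
(* into K on Z; if E had two exits from Z (roots, or arcs leaving Z), then    *)
(* splicing only the part of Z drained by one of them would contradict        *)
(* maximality of k or the fact that Z is never cut by a tree at level k.      *)
(* Thus E restricted to Z is a tree with at most one outgoing arc, and its    *)
(* weight is compared with that of any other tree by plugging both into K.    *)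
(* A forest with m trees and an arc out of Z is obtained by minimizing the    *)
(* number of roots among the optimal maps with such an arc.                   *)

(** In other terms: between [m] and [k] the function [phi] lies on a line of slope [- lam], and it
    bends strictly at both ends. So [phi j] plus [j] times [lam] is a constant [C] there
    ([level_costs]), and exchanging trees shows that it exceeds [C] at every other level
    ([cost_gt_low], [cost_gt_high]). All minimal forests of the levels [m] to [k] thus minimize one
    and the same charged cost, and they can be mixed across levels: two complementary acyclic
    splices of optimal maps are both optimal ([optimal_splice]).

    For the atom, [atom_is_tree] provides a forest [K] having [Z] as a tree. Since an optimal map
    has at most [k] roots, and maps reaching [k] cannot cut [Z], an optimal map has exactly one exit
    from [Z] ([exit_unique_base]): a root in [Z] or an arc leaving it. This gives the two cases of
    the theorem. Minimality of the part on [Z] follows from [plug_cost], a leaving forest at level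
    [m] from [leaving_minimal], and the forest prolonging a given tree from [splice_min_tree]. *)

Section Maps.
Variable N : finType.
Implicit Types (f g h : N -> N) (D : {set N}) (r l : N -> nat).

Definition fixpts f : {set N} := [set x | f x == x].

Definition acyclic_map f : Prop :=
  exists r : N -> nat, forall x, f x != x -> (r (f x) < r x)%N.

(** The root of the tree of [x]: for an acyclic map, [#|N|] steps are enough to reach a fixed point
    ([rt_fix]). *)
Definition rt f (x : N) : N := iter #|N| f x.

Definition splice D g f : N -> N := fun x => if x \in D then g x else f x.

Lemma acyclic_map_bounded f : acyclic_map f ->
  exists2 r : N -> nat, forall x, f x != x -> (r (f x) < r x)%N &
                        forall x, (r x < #|N|)%N.
Proof.
case=> r rP; exists (fun x => #|[set y | r y < r x]|%N) => x.
  move=> /rP lt_fx; apply: proper_card; apply/properP; split.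
    by apply/subsetP => y; rewrite !inE => /ltn_trans; apply.
  by exists (f x); rewrite !inE ?ltnn.
rewrite -cardsT; apply: proper_card; apply/properP.
by split; [exact: subsetT | exists x; rewrite !inE ?ltnn].
Qed.

(** The tool for splices: [l] numbers zones that an orbit can only descend, and [r] is a rank valid
    inside each zone. The two are merged in base [b], larger than all values of [r]. *)
Lemma acyclic_map_lex h l r :
    (forall x, h x != x ->
       (l (h x) < l x)%N \/ l (h x) = l x /\ (r (h x) < r x)%N) ->
  acyclic_map h.
Proof.
move=> lexP; pose b := (\max_x r x).+1.
have lt_b x : (r x < b)%N by rewrite ltnS leq_bigmax.
exists (fun x => l x * b + r x)%N => x /lexP[lt_l | [-> lt_r]].
  apply: (@leq_trans ((l (h x)).+1 * b)%N); first by rewrite mulSn addnC ltn_add2r.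
  by rewrite (leq_trans (leq_mul lt_l (leqnn b))) ?leq_addr.
by rewrite ltn_add2l.
Qed.

Lemma rt_fix f x : acyclic_map f -> f (rt f x) = rt f x.
Proof.
case/acyclic_map_bounded => r rP rlt.
have bound n : f (iter n f x) = iter n f x \/ (r (iter n f x) + n <= r x)%N.
  elim: n => [|n [fixn | IH]]; first by right; rewrite addn0.
    by left; rewrite /= !fixn.
  have [fixn | nfix] := eqVneq (f (iter n f x)) (iter n f x).
    by left; rewrite /= !fixn.
  by right; rewrite addnS /= (leq_trans _ IH) // ltn_add2r rP.
case: (bound #|N|) => // le_r.
by have := leq_trans (leq_addl _ _) le_r; rewrite leqNgt rlt.
Qed.

Lemma iter_fix f n x : f x = x -> iter n f x = x.
Proof. by move=> fx; elim: n => //= n ->. Qed.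

Lemma rt_id f x : f x = x -> rt f x = x.
Proof. exact: iter_fix. Qed.

Lemma rt_step f x : acyclic_map f -> rt f (f x) = rt f x.
Proof. by move=> acf; rewrite /rt -iterSr iterS; apply: rt_fix. Qed.

Lemma acyclic_map_ind f (P : N -> Prop) : acyclic_map f ->
    (forall x, f x = x -> P x) ->
    (forall x, f x != x -> P (f x) -> P x) ->
  forall x, P x.
Proof.
case=> r rP P0 PS x; have [n] := ubnP (r x); elim: n x => // n IH x lt_n.
have [/P0 // | nfix] := eqVneq (f x) x.
by apply: PS => //; apply: IH; rewrite (leq_trans (rP _ nfix)).
Qed.

Lemma rt_closed f D x : (forall y, y \in D -> f y \in D) ->
  x \in D -> rt f x \in D.
Proof. by move=> fD xD; rewrite /rt; elim: #|N| => //= n; apply: fD. Qed.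

Definition tree_of f x : {set N} := [set y | rt f y == rt f x].

Lemma tree_of_inv f x y : acyclic_map f ->
  (f y \in tree_of f x) = (y \in tree_of f x).
Proof. by move=> acf; rewrite !inE rt_step. Qed.

Lemma fixpts_tree f x : acyclic_map f -> fixpts f :&: tree_of f x = [set rt f x].
Proof.
move=> acf; apply/setP=> y; rewrite !inE; apply/andP/eqP => [[/eqP fy] | ->].
  by rewrite rt_id // => /eqP.
by rewrite (rt_id (rt_fix x acf)) rt_fix // !eqxx.
Qed.

(** An orbit may leave [D] but never returns, since [f] preserves the complement of [D]. *)
Lemma acyclic_spliceI D f g : acyclic_map f -> acyclic_map g ->
  (forall x, x \notin D -> f x \notin D) -> acyclic_map (splice D g f).
Proof.
move=> [rf rfP] [rg rgP] fD.
apply: (@acyclic_map_lex _ (fun x => x \in D)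
  (fun x => if x \in D then rg x else rf x)) => x; rewrite /splice.
case: (boolP (x \in D)) => [xD /rgP lt_g | xD nfix].
  by case: (boolP (g x \in D)) => gD; [right | left].
by right; rewrite (negPf (fD _ xD)); split=> //; apply: rfP.
Qed.

(** The mirror case: an orbit may enter [D] but never leaves it. *)
Lemma acyclic_spliceO D f g : acyclic_map f -> acyclic_map g ->
  (forall x, x \in D -> g x \in D) -> acyclic_map (splice D g f).
Proof.
move=> [rf rfP] [rg rgP] gD.
apply: (@acyclic_map_lex _ (fun x => x \notin D)
  (fun x => if x \in D then rg x else rf x)) => x; rewrite /splice.
case: (boolP (x \in D)) => [xD /rgP lt_g | xD /rfP lt_f].
  by right; rewrite (gD _ xD).
by case: (boolP (f x \in D)) => fD; [left | right].
Qed.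

Lemma card_fixpts_splice D f g :
  #|fixpts (splice D g f)| = (#|fixpts g :&: D| + #|fixpts f :\: D|)%N.
Proof.
rewrite -(cardsID D); congr (_ + _)%N; apply: eq_card => x;
  by rewrite !inE /splice; case: (x \in D); rewrite ?andbF ?andbT.
Qed.

Lemma card_fixpts_spliceT f g y : acyclic_map f ->
  #|fixpts (splice (tree_of f y) f g)| = (#|fixpts g :\: tree_of f y|).+1.
Proof. by move=> acf; rewrite card_fixpts_splice fixpts_tree ?cards1. Qed.

Lemma card_fixpts_spliceT' f g y : acyclic_map f ->
  #|fixpts (splice (tree_of f y) g f)| =
  (#|fixpts g :&: tree_of f y| + #|fixpts f|.-1)%N.
Proof.
by move=> acf; rewrite card_fixpts_splice cardsD fixpts_tree ?cards1 ?subn1.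
Qed.

End Maps.

(** * Charged costs and the exchange of trees between forests *)

Section Costs.
Variables (R : realFieldType) (N : finType) (V : digraph N) (v : N * N -> R).
Implicit Types (f g h : N -> N) (D : {set N}) (lam : R).

Definition step_cost lam (x y : N) : R := if y == x then lam else v (x, y).

Definition cost lam f : R := \sum_x step_cost lam x (f x).

Definition valid f : Prop :=
  acyclic_map f /\ forall x, f x != x -> (x, f x) \in arcs V.

Definition optimal lam f : Prop :=
  valid f /\ forall g, valid g -> cost lam f <= cost lam g.

Definition minimal (j : nat) f : Prop :=
  [/\ valid f, #|fixpts f| = j &
      forall g, valid g -> #|fixpts g| = j -> cost 0 f <= cost 0 g].

Lemma cost_fixpts lam f : cost lam f = cost 0 f + lam *+ #|fixpts f|.
Proof.
have -> : lam *+ #|fixpts f| = \sum_x (if f x == x then lam else 0).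
  rewrite -big_mkcond /= sumr_const; congr (_ *+ _).
  by apply: eq_card => x; rewrite !inE.
rewrite -big_split /=; apply: eq_bigr => x _; rewrite /step_cost.
by case: eqP; rewrite ?add0r ?addr0.
Qed.

(** At each vertex the two splices share out the choices of [f] and [g], so the total is
    conserved. *)
Lemma cost_splice lam D f g :
  cost lam (splice D g f) + cost lam (splice D f g) = cost lam f + cost lam g.
Proof.
rewrite -!big_split /=; apply: eq_bigr => x _; rewrite /splice.
by case: ifP => // _; rewrite addrC.
Qed.

Lemma valid_splice D f g : valid f -> valid g -> acyclic_map (splice D g f) ->
  valid (splice D g f).
Proof.
move=> [_ fV] [_ gV] ac; split=> // x; rewrite /splice.
by case: ifP => _; [exact: gV|exact: fV].
Qed.

Lemma optimal_splice lam D f g : optimal lam f -> optimal lam g ->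
  acyclic_map (splice D f g) -> acyclic_map (splice D g f) ->
  optimal lam (splice D f g).
Proof.
move=> [fv fopt] [gv gopt] acfg acgf.
have vgf := valid_splice fv gv acgf; have vfg := valid_splice gv fv acfg.
split=> // h hv; apply: le_trans (fopt _ hv).
by have := cost_splice lam D f g; have := gopt _ vgf; have := fopt _ vgf; lra.
Qed.

Section Tree.
Variables (f g : N -> N) (y : N).
Hypotheses (fv : valid f) (gv : valid g).
Let B := tree_of f y.

Lemma valid_spliceT : valid (splice B f g).
Proof.
apply: valid_splice => //; case: fv gv => [? _] [? _].
by apply: acyclic_spliceO => // *; rewrite tree_of_inv.
Qed.

Lemma valid_spliceT' : valid (splice B g f).
Proof.
apply: valid_splice => //; case: fv gv => [? _] [? _].
by apply: acyclic_spliceI => // *; rewrite tree_of_inv.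
Qed.

End Tree.

(** A tree of [f] and its complement are both closed under [f], so both splices along it are
    acyclic, whatever [g] is. *)
Lemma optimal_spliceT' lam f g y : optimal lam f -> optimal lam g ->
  optimal lam (splice (tree_of f y) g f).
Proof.
move=> fo go; apply: optimal_splice => //.
  by case: (valid_spliceT' y fo.1 go.1).
by case: (valid_spliceT y fo.1 go.1).
Qed.

(** Pigeonhole: the elements of [A] lie in at most [#|A|] trees, fewer than [f] has. *)
Lemma tree_avoiding (A : {set N}) f : acyclic_map f ->
  (#|A| < #|fixpts f|)%N -> exists2 y, f y = y & A :&: tree_of f y = set0.
Proof.
move=> acf ltA; have : ~~ (fixpts f \subset rt f @: A).
  by apply: contraL ltA => /subset_leq_card le; rewrite -leqNgt (leq_trans le) ?leq_imset_card.
case/subsetPn=> y; rewrite inE => /eqP fy ynA; exists y => //.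
apply/setP=> a; rewrite !inE (rt_id fy); apply/negbTE/negP=> /andP[aA /eqP ra].
by rewrite -ra imset_f in ynA.
Qed.

(** * Minimal forests of levels [m] to [k] are the global optima of the charged cost *)

Section Levels.
Variables (lam C : R) (m k : nat).
Hypothesis le_mk : (m <= k)%N.
Hypothesis minimal_ex : forall j, (m <= j <= k)%N ->
  exists2 f, minimal j f & cost lam f = C.
Hypothesis low : forall f, valid f -> #|fixpts f| = m.-1 -> C < cost lam f.
Hypothesis high : forall f, valid f -> #|fixpts f| = k.+1 -> C < cost lam f.

Lemma minimal_cost j f : (m <= j <= k)%N -> minimal j f -> cost lam f = C.
Proof.
move=> /minimal_ex[g [gv gj gmin] <-] [fv fj fmin].
by rewrite !(cost_fixpts lam) fj gj; congr (_ + _); apply/le_anti; rewrite fmin // gmin.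
Qed.

Lemma cost_ge_mid f : valid f -> (m <= #|fixpts f| <= k)%N -> C <= cost lam f.
Proof.
move=> fv /minimal_ex[g [gv gj gmin] <-].
by rewrite !(cost_fixpts lam) gj lerD2r gmin.
Qed.

(** Some tree of [f] avoids the roots of a minimal [K] with [k] roots. Exchanging along it gives one
    map with [k + 1] roots, costing more than [C] by [high], and one with one root fewer than [f],
    costing at least [C] by induction or by [cost_ge_mid]. Their costs add up to that of [f] plus
    [C]. *)
Lemma cost_gt_high f : valid f -> (k < #|fixpts f|)%N -> C < cost lam f.
Proof.
have [n] := ubnP #|fixpts f|; elim: n f => // n IH f lt_n fv gtk.
have [K [Kv Kk _] KC] := @minimal_ex k ltac:(by rewrite le_mk leqnn).
have [|y fy Ky] := @tree_avoiding (fixpts K) f fv.1; first by rewrite Kk.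
have c1 := card_fixpts_spliceT K y fv.1; have c2 := card_fixpts_spliceT' K y fv.1.
have KD : fixpts K :\: tree_of f y = fixpts K.
  by apply/setDidPl; rewrite -setI_eq0 Ky.
rewrite KD Kk in c1; rewrite Ky cards0 add0n in c2.
have := high (valid_spliceT y fv Kv) c1.
have v2 := valid_spliceT' y fv Kv.
have : C <= cost lam (splice (tree_of f y) K f).
  have [lt|le] := ltnP k #|fixpts (splice (tree_of f y) K f)|.
    by apply/ltW/IH => //; rewrite c2; case: #|_| gtk lt_n.
  by apply: cost_ge_mid => //; rewrite le andbT c2; move: gtk; lia.
by have := cost_splice lam (tree_of f y) f K; rewrite KC; lra.
Qed.

(** The same exchange upwards: a tree of a minimal [H] with [m] roots avoids the roots of [f], and
    the two splices have [m - 1] roots and one root more than [f]. *)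
Lemma cost_gt_low f : valid f -> (#|fixpts f| < m)%N -> C < cost lam f.
Proof.
have [n] := ubnP (m - #|fixpts f|)%N; elim: n f => // n IH f lt_n fv ltm.
have [H [Hv Hm _] HC] := @minimal_ex m ltac:(by rewrite le_mk leqnn).
have [|y Hy fB] := @tree_avoiding (fixpts f) H Hv.1; first by rewrite Hm.
have c1 := card_fixpts_spliceT f y Hv.1; have c2 := card_fixpts_spliceT' f y Hv.1.
have fD : fixpts f :\: tree_of H y = fixpts f.
  by apply/setDidPl; rewrite -setI_eq0 fB.
rewrite fD in c1; rewrite fB cards0 add0n Hm in c2.
have := low (valid_spliceT' y Hv fv) c2.
have v1 := valid_spliceT y Hv fv.
have : C <= cost lam (splice (tree_of H y) H f).
  have [lt|le] := ltnP #|fixpts (splice (tree_of H y) H f)| m.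
    by apply/ltW/IH => //; rewrite c1; move: lt_n ltm; lia.
  by apply: cost_ge_mid => //; rewrite le c1 (leq_trans ltm).
by have := cost_splice lam (tree_of H y) H f; rewrite HC; lra.
Qed.

Lemma cost_ge f : valid f -> C <= cost lam f.
Proof.
move=> fv; have [lt|le] := ltnP #|fixpts f| m; first exact/ltW/cost_gt_low.
have [lt|le'] := ltnP k #|fixpts f|; first exact/ltW/cost_gt_high.
by apply: cost_ge_mid; rewrite ?le.
Qed.

Lemma minimal_optimal j f : (m <= j <= k)%N -> minimal j f -> optimal lam f.
Proof.
move=> jmk fmin; split; first by case: fmin.
by move=> g gv; rewrite (minimal_cost jmk fmin) cost_ge.
Qed.

Lemma optimal_cost f : optimal lam f -> cost lam f = C.
Proof.
move=> [fv fmin]; apply/le_anti; rewrite cost_ge // andbT.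
have [g [gv _ _] <-] := @minimal_ex m ltac:(by rewrite le_mk leqnn).
exact: fmin.
Qed.

Lemma optimal_card f : optimal lam f -> (m <= #|fixpts f| <= k)%N.
Proof.
move=> fo; have fC := optimal_cost fo; case: fo => fv _.
apply/andP; split; rewrite leqNgt; apply/negP.
  by move/(cost_gt_low fv); rewrite fC ltxx.
by move/(cost_gt_high fv); rewrite fC ltxx.
Qed.

Lemma optimal_minimal j f : optimal lam f -> #|fixpts f| = j -> minimal j f.
Proof.
move=> fo fj; split=> //; first by case: fo.
move=> g gv gj; have := fo.2 g gv.
by rewrite !(cost_fixpts lam) gj fj lerD2r.
Qed.

End Levels.
End Costs.

(** * Optimal maps around a labeled atom *)

Section Atom.
Variables (R : realFieldType) (N : finType) (V : digraph N) (v : N * N -> R).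
Variables (lam : R) (m k : nat) (Z : {set N}).
Implicit Types (f g h E H : N -> N).

Local Notation optimal := (optimal V v lam).

Hypothesis optimal_card : forall f, optimal f -> (m <= #|fixpts f| <= k)%N.

Definition top f : Prop := optimal f /\ #|fixpts f| = k.

Hypothesis top_conn : forall f y z, top f -> y \in Z -> z \in Z -> rt f y = rt f z.
Hypothesis top_sep : forall u z, u \notin Z -> z \in Z ->
  exists2 f, top f & rt f u <> rt f z.

(* If u outside Z shares the tree of x, then copying K only on the tree of x  *)
(* in a forest separating u from Z shrinks that tree without moving its root. *)
Lemma atom_is_tree f x : top f -> x \in Z -> f x = x ->
  exists K, [/\ top K, K x = x & tree_of K x = Z].
Proof.
have [n] := ubnP #|tree_of f x|; elim: n f => // n IH f lt_n ftop xZ fx.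
have [|/subsetPn[u]] := boolP (tree_of f x \subset Z).
  move=> sTZ; exists f; split=> //; apply/eqP; rewrite eqEsubset sTZ.
  by apply/subsetP=> z zZ; rewrite inE (top_conn ftop zZ xZ).
rewrite inE => /eqP ux uZ; have [g gtop gu] := top_sep uZ xZ.
have [[fo fk] [go gk]] := (ftop, gtop).
have [[acf _] [acg _]] := (fo.1, go.1).
pose D := tree_of g x; pose h := splice D f g.
have ho : optimal h := optimal_spliceT' x go fo.
have [ach _] := ho.1.
have hx : h x = x by rewrite /h /splice inE eqxx.
(* Outside [D] the map [h] keeps all roots of [g] but one, and inside it has at least the root [x]
   of [f]. So it has at least [k] roots, and optimality forbids more. *)
have htop : top h.
  split=> //; apply/eqP; rewrite eqn_leq; case/andP: (optimal_card ho) => _ -> /=.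
  rewrite card_fixpts_spliceT' ?gk //.
  have : (0 < #|fixpts f :&: tree_of g x|)%N.
    by apply/card_gt0P; exists x; rewrite !inE fx !eqxx.
  by lia.
(* The new tree of [x] lies in both old ones: no arc of [g] enters [D] from outside, and inside [D]
   the arcs are those of [f]. *)
have sub w : rt h w = x -> w \in D /\ rt f w = x.
  apply: (acyclic_map_ind (P := fun w => rt h w = x -> _) ach) w => [w hw|w nfix IHw].
    by rewrite rt_id // => ->; rewrite inE eqxx rt_id.
  rewrite -rt_step // => /IHw []; rewrite /h /splice.
  case: ifP => wD; first by rewrite rt_step.
  by rewrite /D tree_of_inv // -/D wD.
apply: (IH h) => //; rewrite ltnS in lt_n; apply: leq_trans lt_n; apply: proper_card; apply/properP; split.
  by apply/subsetP=> w; rewrite !inE (rt_id hx) (rt_id fx) => /eqP/sub[_ ->].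
exists u; rewrite inE ?ux // (rt_id hx); apply/eqP=> /sub[].
by rewrite inE => /eqP.
Qed.

Variables (K : N -> N) (x : N).
Hypotheses (Ktop : top K) (Kx : K x = x) (KZ : tree_of K x = Z).

Let acK : acyclic_map K. Proof. by case: Ktop.1.1. Qed.

Lemma base_closed u : (K u \in Z) = (u \in Z).
Proof. by rewrite -KZ tree_of_inv. Qed.

Lemma base_root : x \in Z.
Proof. by rewrite -KZ inE. Qed.

Lemma base_fixpts : fixpts K :&: Z = [set x].
Proof. by rewrite -KZ fixpts_tree // rt_id. Qed.

Lemma optimal_plug E : optimal E -> optimal (splice Z E K).
Proof. by rewrite -KZ; apply: optimal_spliceT'; case: Ktop. Qed.

(** Roots of [E] in [Z] and tails of arcs leaving [Z] all become fixed points, so that the two kinds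
    of exits are treated together. *)
Definition confine E : N -> N := fun u => if E u \in Z then E u else u.

Lemma acyclic_confine E : acyclic_map E -> acyclic_map (confine E).
Proof.
case=> r rP; exists r => u; rewrite /confine; case: ifP => _; first exact: rP.
by rewrite eqxx.
Qed.

Lemma confine_closed E u : u \in Z -> confine E u \in Z.
Proof. by rewrite /confine; case: ifP. Qed.

Lemma confine_exit E e : e \in Z ->
  (confine E e == e) = (E e == e) || (E e \notin Z).
Proof.
by rewrite /confine => eZ; case: ifP => EeZ; rewrite ?orbF ?eqxx ?orbT.
Qed.

Lemma rt_confine E u : acyclic_map E -> rt E (rt (confine E) u) = rt E u.
Proof.
move=> acE; rewrite [rt (confine E) u]/rt; elim: #|N| => //= n <-.
by rewrite {1}/confine; case: ifP => // _; rewrite rt_step.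
Qed.

(** Every exit is compared with the one draining [x], the root of [K] in [Z]. If [e] were another
    exit, the part [D] of [Z] drained by [e] would miss [x]. Using [E] on [D] and [K] elsewhere then
    either gives more than [k] roots, or gives [k] roots and cuts [Z]. *)
Lemma exit_unique_base E e : optimal E -> e \in Z -> confine E e = e ->
  rt (confine E) x = e.
Proof.
move=> Eo eZ ce; apply/eqP/negPn/negP => ne.
have acE : acyclic_map E by case: Eo.1.
have acc := acyclic_confine acE.
pose F := splice Z E K; have Fo : optimal F := optimal_plug Eo.
pose D := [set u in Z | rt (confine E) u == e].
have rtc u : E u \in Z -> rt (confine E) (E u) = rt (confine E) u.
  by move=> EuZ; rewrite -[RHS]rt_step //; congr rt; rewrite /confine EuZ.
have DE u : u \in D -> E u \in Z -> E u \in D.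
  by rewrite !inE => /andP[_ ru] EuZ; rewrite rtc // ru andbT.
have DE' u : u \in Z -> u \notin D -> E u \notin D.
  rewrite !inE => -> /=; apply: contraNN => /andP[EuZ].
  by rewrite rtc.
have DZ u : u \in D -> u \in Z by rewrite inE => /andP[].
have xD : x \notin D by rewrite inE base_root.
have [rK rKP] := acK; have [rE rEP] := acE.
(* Orbits descend from [Z] minus [D] to [D], then out of [Z] for good; in [acB] the zones [D] and
   [Z] minus [D] are interchanged. *)
have acA : acyclic_map (splice D F K).
  apply: (@acyclic_map_lex _ _ (fun u => (u \in Z) + (u \in Z :\: D))%N
    (fun u => if u \in D then rE u else rK u)) => u.
  rewrite /splice /F /splice !in_setD; case: (boolP (u \in D)) => uD.
    rewrite (DZ _ uD) => /rEP lt; have [EZ|EZ] := boolP (E u \in Z); last by left; rewrite andbF.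
    by right; rewrite (DE _ uD EZ).
  move=> /rKP lt; rewrite base_closed; have [uZ|uZ] := boolP (u \in Z).
    by case: (boolP (K u \in D)) => KD; [left|right].
  by right; rewrite (contraNF (@DZ _)) // ?base_closed.
have acB : acyclic_map (splice D K F).
  apply: (@acyclic_map_lex _ _ (fun u => (u \in Z) + (u \in D))%N
    (fun u => if u \in D then rK u else if u \in Z then rE u else rK u)) => u.
  rewrite /splice /F /splice; case: (boolP (u \in D)) => uD.
    move=> /rKP lt; rewrite base_closed (DZ _ uD).
    by case: (boolP (K u \in D)) => KD; [right|left].
  have [uZ /rEP lt|uZ /rKP lt] := boolP (u \in Z).
    rewrite (negPf (DE' _ uZ uD)); have [EZ|EZ] := boolP (E u \in Z); [by right|by left].
  by right; rewrite (contraNF (@DZ _)) base_closed // (negPf uZ).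
have Ao : optimal (splice D F K) by apply: optimal_splice => //; case: Ktop.
(* No root of [K] is lost, since its only root in [Z] is [x], outside [D]. *)
have fixA : #|fixpts (splice D F K)| = (#|fixpts E :&: D| + k)%N.
  rewrite card_fixpts_splice; congr (_ + _)%N.
    apply: eq_card=> u; rewrite [LHS]inE [RHS]inE !(inE, in_setI) /F /splice.
    by case: (boolP (u \in Z)) => //=; rewrite ?andbF.
  rewrite -Ktop.2; congr #|pred_of_set _|; apply/setDidPl; rewrite disjoint_sym disjoints_subset.
  apply/subsetP=> u uD; rewrite !inE; apply: contraNN xD => /eqP Ku.
  have : u \in fixpts K :&: Z by rewrite in_setI DZ // inE Ku eqxx.
  by rewrite base_fixpts inE => /eqP <-.
have fixE0 : #|fixpts E :&: D| = 0%N.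
  by have := optimal_card Ao; rewrite fixA; lia.
have eD : e \in D by rewrite inE eZ rt_id // eqxx.
have EeZ : E e \notin Z.
  have /eqP := ce; rewrite confine_exit // => /orP[/eqP Ee|//].
  by have := card0_eq fixE0 e; rewrite in_setI eD inE Ee eqxx.
have Atop : top (splice D F K) by split=> //; rewrite fixA fixE0.
(* Here [x] is still a root, while [e] is sent out of [Z] and its orbit cannot come back. *)
have := top_conn Atop eZ base_root.
have Ax : splice D F K x = x by rewrite /splice (negPf xD).
have Ae : splice D F K e = E e by rewrite /splice eD /F /splice eZ.
rewrite (rt_id Ax) -rt_step // Ae => rtA.
have : rt (splice D F K) (E e) \in ~: Z.
  apply: rt_closed; last by rewrite inE.
  move=> u; rewrite !in_setC /splice => uZ.
  by rewrite (contraNF (@DZ _) uZ) base_closed.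
by rewrite rtA inE base_root.
Qed.

Definition exit E : N := rt (confine E) x.

Lemma exit_in E : exit E \in Z.
Proof. exact: rt_closed (@confine_closed E) base_root. Qed.

Section Optimal.
Variable E : N -> N.
Hypothesis Eo : optimal E.
Let acE : acyclic_map E. Proof. by case: Eo.1. Qed.

Lemma confine_fix : confine E (exit E) = exit E.
Proof. exact/rt_fix/acyclic_confine. Qed.

Lemma confine_exitE u : u \in Z -> (confine E u == u) = (u == exit E).
Proof.
move=> uZ; apply/eqP/eqP => [cu | ->]; last exact: confine_fix.
by rewrite /exit (exit_unique_base Eo uZ cu).
Qed.

Lemma rt_exit u : u \in Z -> rt E u = rt E (exit E).
Proof.
move=> uZ; rewrite -rt_confine //.
have rZ := rt_closed (@confine_closed E) uZ.
have : confine E (rt (confine E) u) == rt (confine E) u.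
  by apply/eqP/rt_fix/acyclic_confine.
by rewrite confine_exitE // => /eqP ->.
Qed.

Lemma leaves_exit u : u \in Z -> E u \notin Z -> u = exit E.
Proof. by move=> uZ EuZ; apply/eqP; rewrite -confine_exitE // confine_exit // EuZ orbT. Qed.

End Optimal.

(* Fewest roots among the optimal forests leaving Z: another tree of such a   *)
(* forest without roots of H could be dissolved by copying H on it.           *)
Lemma leaving_minimal E H z : optimal E -> optimal H -> #|fixpts H| = m ->
  z \in Z -> E z \notin Z ->
  exists G, [/\ optimal G, #|fixpts G| = m & exists2 y, y \in Z & G y \notin Z].
Proof.
move=> + Ho Hm; have [n] := ubnP #|fixpts E|; elim: n E z => // n IH E z lt_n Eo zZ Ez.
have [Em|neE] := eqVneq #|fixpts E| m; first by exists E; split=> //; exists z.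
have gtm : (m < #|fixpts E|)%N by rewrite ltn_neqAle eq_sym neE; case/andP: (optimal_card Eo).
have [/exists_inP[y yZ Hy]|/exists_inPn Hcl] := boolP [exists y in Z, H y \notin Z].
  by exists H; split=> //; exists y.
have acH : acyclic_map H by case: Ho.1.
have acE : acyclic_map E by case: Eo.1.
have rH : rt H x \in fixpts H :&: Z.
  rewrite in_setI [_ \in fixpts _]inE rt_fix // eqxx /=; apply: rt_closed base_root => y /Hcl.
  by rewrite negbK.
have rH0 : (0 < #|fixpts H :&: Z|)%N by apply/card_gt0P; exists (rt H x).
(* [H] has a root in [Z], so dropping its roots in [Z] compensates for adding [rt E z], and [A] has
   at most [m] elements. Avoiding [rt E z] keeps the dissolved tree away from all of [Z], which lies
   in a single tree of [E]. *)
pose A := rt E z |: fixpts H :\: Z.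
have [|y Ey Ay] := @tree_avoiding _ A E acE.
  apply: leq_ltn_trans gtm; rewrite cardsU1 cardsD Hm.
  have := leq_b1 (rt E z \notin fixpts H :\: Z).
  by move: rH0; have := subset_leq_card (subsetIl (fixpts H) Z); rewrite Hm; lia.
have yz : rt E z != y.
  apply/negP=> /eqP ryz; have := in_set0 (rt E z).
  by rewrite -Ay !inE eqxx ryz (rt_id Ey) eqxx.
have Zy u : u \in Z -> u \notin tree_of E y.
  by move=> uZ; rewrite inE (rt_id Ey) (rt_exit Eo uZ) -(rt_exit Eo zZ).
have HB : fixpts H :&: tree_of E y = set0.
  apply/setP=> u; rewrite in_set0; apply/negbTE/negP; rewrite in_setI => /andP[Hu uy].
  have uZ : u \notin Z by apply: contraL uy => /Zy.
  by have := in_set0 u; rewrite -Ay in_setI uy andbT /A in_setU1 in_setD uZ Hu orbT.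
apply: (IH (splice (tree_of E y) H E) z) => //; last by rewrite /splice (negPf (Zy z zZ)).
  by rewrite card_fixpts_spliceT' // HB cards0; move: gtm lt_n; lia.
exact: optimal_spliceT'.
Qed.

(* Acyclic for any acyclic t, because no arc of K enters Z.                   *)
Lemma plug_valid t : acyclic_map t -> (forall u, u \in Z -> t u != u -> (u, t u) \in arcs V) ->
  valid V (splice Z t K).
Proof.
move=> act tV; split.
  by apply: acyclic_spliceI => // u; rewrite base_closed.
by move=> u; rewrite /splice; case: ifP => [|_]; [exact: tV | have [_] := Ktop.1.1; apply].
Qed.

(** Plugged into [K], both maps agree outside [Z] and have equally many roots, so optimality of the
    plugged [E] reduces to a comparison on [Z]. As [t] may leave [Z], this serves both kinds of
    trees. *)
Lemma plug_cost E t : optimal E -> valid V (splice Z t K) ->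
  #|fixpts E :&: Z| = #|fixpts t :&: Z| ->
  \sum_(u in Z) step_cost v 0 u (E u) <= \sum_(u in Z) step_cost v 0 u (t u).
Proof.
move=> Eo tv fixEt; have := (optimal_plug Eo).2 _ tv.
rewrite !(cost_fixpts _ lam) !card_fixpts_splice fixEt lerD2r /cost.
rewrite (bigID (mem Z)) [leRHS](bigID (mem Z)) /=.
have eqo g : \sum_(i | i \notin Z) step_cost v 0 i (splice Z g K i) =
         \sum_(i | i \notin Z) step_cost v 0 i (K i).
  by apply: eq_bigr => i iZ; rewrite /splice (negPf iZ).
have eqs g : \sum_(i in Z) step_cost v 0 i (splice Z g K i) =
         \sum_(i in Z) step_cost v 0 i (g i).
  by apply: eq_bigr => i iZ; rewrite /splice iZ.
by rewrite !eqs !eqo lerD2r.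
Qed.

End Atom.

(** * Translation between parent maps and forests as graphs *)

Section Graphs.
Variable N : finType.
Implicit Types (f g : N -> N) (D Z : {set N}) (G : digraph N).

Definition graph D f : digraph N :=
  (D, [set a | [&& a.1 \in D, a.2 != a.1 & a.2 == f a.1]]).

Lemma has_arc_graph D f x y :
  has_arc (graph D f) x y = [&& x \in D, y != x & y == f x].
Proof. by rewrite /has_arc /= inE. Qed.

Lemma eq_graph D f g : {in D, f =1 g} -> graph D f = graph D g.
Proof.
move=> fg; congr pair; apply/setP=> -[a b]; rewrite !inE /=.
by case: (boolP (a \in D)) => //= /fg ->.
Qed.

Lemma graph_forest D f : acyclic_map f -> is_forest (graph D f).
Proof.
move=> [r rP]; apply/andP; split.
  apply/acyclicP=> -[//|x c] /andP[]; rewrite /cycle.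
  have sub : subrel (has_arc (graph D f)) (fun x y => r y < r x)%N.
    by move=> a b; rewrite has_arc_graph => /and3P[_ nab /eqP eb]; subst b; apply: rP.
  move=> /(sub_path sub)/(order_path_min (fun a b d lt1 lt2 => ltn_trans lt2 lt1)).
  by rewrite all_rcons ltnn.
apply/forallP=> x; rewrite -(cards1 (f x)); apply: subset_leq_card.
by apply/subsetP=> y; rewrite !inE has_arc_graph => /and3P[].
Qed.

Lemma forest_graph G : is_forest G -> arcs G \subset setX (vset G) (vset G) ->
    (forall x, ~~ has_arc G x x) ->
  exists f, [/\ acyclic_map f, forall x, x \in vset G -> f x \in vset G &
                graph (vset G) f = G].
Proof.
case: G => D A /andP[/acyclicP acG /forallP degG] /= /subsetP AD noloop.
set G := (D, A) in acG degG noloop.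
pose f x := odflt x [pick y | has_arc G x y].
have fP x y : has_arc G x y = (y != x) && (y == f x).
  rewrite /f; case: pickP => [z xz|none] /=; last by rewrite none; case: eqP.
  apply/idP/andP=> [xy|[_ /eqP->//]]; split.
    by apply: contraNneq (noloop x) => yx; rewrite -{2}yx.
  have := degG x; rewrite leqNgt; apply: contraNT => nyz.
  rewrite (cardsD1 y) inE xy (cardsD1 z) !inE xz eq_sym.
  by rewrite nyz.
have fA x : f x != x -> (x, f x) \in A.
  by move=> nfx; have := fP x (f x); rewrite nfx eqxx.
exists f; split; last 2 first.
- move=> x xD; have [->//|/fA/AD] := eqVneq (f x) x.
  by rewrite inE => /andP[].
- congr pair; apply/setP=> -[a b]; rewrite inE /= -[RHS]/(has_arc G a b) fP.
  apply/andP/idP=> [[//]|ab]; split=> //.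
  have : (a, b) \in A by rewrite -[_ \in _]/(has_arc G a b) fP.
  by move/AD; rewrite inE => /andP[].
(* The number of reachable vertices is a rank: it drops from [x] to [f x], because a path from [f x]
   back to [x] would close a cycle. *)
exists (fun x => #|connect (has_arc G) x|) => x nfx.
have xfx : has_arc G x (f x) := fA x nfx.
apply: proper_card; apply/properP; split.
  apply/subsetP=> y; rewrite -!topredE /=; apply: connect_trans.
  exact: connect1.
exists x; rewrite -?topredE /= ?connect0 //; apply/negP => /connectP[p pathp].
move=> lastp; case: (shortenP pathp) lastp => q pathq uq _ lastq.
have := acG (f x :: q); rewrite /ucycle uq andbT /cycle rcons_path pathq -lastq xfx.
by move=> /(_ isT).
Qed.

Section Components.
Variables (D : {set N}) (f : N -> N).
Hypotheses (acf : acyclic_map f) (fD : forall x, x \in D -> f x \in D).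
Local Notation G := (graph D f).

Lemma adj_rt x y : adj G x y -> rt f x = rt f y.
Proof.
rewrite /adj /= !has_arc_graph => /orP[] /and3P[_ _ /eqP->]; by rewrite rt_step.
Qed.

Lemma connect_adj x y : x \in D -> y \in D ->
  connect (adj G) x y = (rt f x == rt f y).
Proof.
have symG : connect_sym (adj G).
  by apply: sym_connect_sym => a b; rewrite /adj /= orbC.
have to_rt z : z \in D -> connect (adj G) z (rt f z).
  apply: (acyclic_map_ind (P := fun z => z \in D -> _) acf) z => z.
    by move=> fz _; rewrite rt_id.
  move=> nfz IH zD; rewrite -rt_step //; apply: connect_trans (IH (fD zD)).
  by apply: connect1; rewrite /adj /= !has_arc_graph zD nfz eqxx.
have path_rt p : forall z, path (adj G) z p -> rt f z = rt f (last z p).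
  by elim: p => //= w p IH z /andP[/adj_rt-> /IH].
move=> xD yD; apply/idP/eqP=> [/connectP[p /path_rt-> ->] // | eq_rt].
by apply: connect_trans (to_rt x xD) _; rewrite eq_rt symG; apply: to_rt.
Qed.

Lemma componentsE :
  components G = [set induced G (D :&: tree_of f x) | x in D].
Proof.
rewrite /components /equivalence_partition -imset_comp; apply: eq_in_imset => x xD /=.
congr induced; apply/setP=> y; rewrite !inE.
by case: (boolP (y \in D)) => // yD; rewrite connect_adj // eq_sym.
Qed.

Lemma vset_component x : vset (induced G (D :&: tree_of f x)) = D :&: tree_of f x.
Proof. by rewrite /vset /= setIA setIid. Qed.

Lemma card_components : #|components G| = #|fixpts f :&: D|.
Proof.
have -> : components G = [set induced G (D :&: tree_of f x) | x in fixpts f :&: D].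
  rewrite componentsE; apply/setP=> T; apply/imsetP/imsetP=> -[x].
    move=> xD ->; exists (rt f x); first by rewrite !inE rt_fix // eqxx rt_closed.
    by rewrite /tree_of (rt_id (rt_fix x acf)).
  by rewrite inE => /andP[_ xD] ->; exists x.
rewrite card_in_imset // => x y; rewrite !inE => /andP[/eqP fx xD] /andP[/eqP fy yD].
move=> /(congr1 (@vset N)); rewrite !vset_component => /setP/(_ x).
by rewrite !inE xD eqxx /= rt_id // (rt_id fy) => /esym/eqP.
Qed.

End Components.

Lemma Nout_graph Z f : reflect (exists2 z, z \in Z & f z \notin Z)
  (Nout Z (graph setT f) != set0).
Proof.
apply: (iffP (set0Pn _)) => [[y]|[z zZ fz]].
  rewrite inE => /andP[yZ /exists_inP[z zZ]]; rewrite has_arc_graph => /and3P[_ _ /eqP yf].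
  by exists z; rewrite // -yf.
exists (f z); rewrite inE fz; apply/exists_inP; exists z => //.
by rewrite has_arc_graph !inE eqxx andbT /=; apply: contraNneq fz => ->.
Qed.

Lemma induced_graph Z f : induced (graph setT f) Z = graph Z (confine Z f).
Proof.
congr pair; first by rewrite /= setTI.
apply/setP=> -[a b]; rewrite !inE /= /confine.
case: (boolP (a \in Z)) => aZ; rewrite ?andbF //=.
case: (eqVneq b a) => //= nba; case: (eqVneq b (f a)) => [eb|nb] /=.
  by subst b; case: ifP => fa; rewrite ?eqxx // (negPf nba).
by case: ifP => fa; apply/esym/negbTE.
Qed.

(** Freezing the map outside [Z] turns the heads of the leaving arcs into roots. *)
Lemma outres_graph Z f : outres (graph setT f) Z =
  graph (Z :|: Nout Z (graph setT f)) (fun u => if u \in Z then f u else u).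
Proof.
congr pair; apply/setP=> -[a b]; rewrite [LHS]inE [RHS]inE [_ \in arcs _]inE in_setT in_setU /=.
by case: (a \in Z); rewrite /= ?andbT ?andbF //; case: eqP => //=; rewrite ?andbF.
Qed.

Lemma weight_graph (R : realFieldType) (v : N * N -> R) D f :
  weight v (graph D f) = \sum_(x in D) step_cost v 0 x (f x).
Proof.
rewrite /weight /weight_in.
have -> : arcs (graph D f) = [set (x, f x) | x in [set x in D | f x != x]].
  apply/setP=> -[a b]; rewrite !inE /=; apply/and3P/imsetP=> [[aD nba /eqP ebf]|[x]].
    by exists a; rewrite ?inE ?aD -?ebf.
  by rewrite inE => /andP[xD nfx] [-> ->].
rewrite big_mkcondr big_imset /=; last by move=> x y _ _ [].
rewrite big_mkcond [RHS]big_mkcond; apply: eq_bigr => x _; rewrite !inE /step_cost.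
by case: (x \in D) => //=; case: eqP.
Qed.

End Graphs.

Lemma minimizersP (R : realFieldType) (N : finType) (v : N * N -> R)
    (S : {set digraph N}) (G : digraph N) :
  reflect (G \in S /\ forall H, H \in S -> weight v G <= weight v H)
          (G \in minimizers v S).
Proof.
rewrite inE; apply: (iffP andP) => -[GS] => [/eqP minG | minG]; split=> //.
  by move=> H HS; rewrite -lee_fin minG; apply: bigmin_le_cond.
apply/eqP/le_anti; rewrite bigmin_le_cond // andbT.
by apply: le_bigmin => [|H HS]; rewrite ?leey // lee_fin minG.
Qed.

(** * Forests, trees and [phi] in terms of maps *)

Section Bridge.
Variables (R : realFieldType) (N : finType) (V : digraph N) (v : N * N -> R).
Hypothesis spanning_V : vset V = [set: N].
Hypothesis loopless_V : forall x : N, ~~ has_arc V x x.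
Implicit Types (f : N -> N) (D Z : {set N}) (G : digraph N).

Lemma graph_subgraph D f : (forall x, x \in D -> f x \in D) ->
  (forall x, x \in D -> f x != x -> (x, f x) \in arcs V) ->
  subgraph (graph D f) V.
Proof.
move=> fD fV; apply/and3P; split; first by rewrite spanning_V subsetT.
  by apply/subsetP=> -[a b]; rewrite inE /= => /and3P[aD nba /eqP eb]; subst b; apply: fV.
by apply/subsetP=> -[a b]; rewrite !inE /= => /and3P[aD nba /eqP->]; rewrite aD fD.
Qed.

Lemma subgraph_graph G : subgraph G V -> is_forest G ->
  exists f, [/\ acyclic_map f, forall x, x \in vset G -> f x \in vset G,
    forall x, x \in vset G -> f x != x -> (x, f x) \in arcs V &
    graph (vset G) f = G].
Proof.
move=> /and3P[_ /subsetP GV Gv] Gf.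
have [|f [acf fG eG]] := forest_graph Gf Gv.
  by move=> x; apply: contra (loopless_V x) => /GV.
exists f; split=> // x xG nfx; apply: GV; rewrite -eG.
by rewrite inE /= xG nfx eqxx.
Qed.

Lemma forestsP j G : reflect
  (exists2 f, valid V f /\ #|fixpts f| = j & G = graph setT f)
  (G \in forests V j).
Proof.
rewrite inE; apply: (iffP and4P) => [[GV /eqP GT Gf Gj]|[f [[acf fV] fj] ->]].
  have [f [acf _ fV eG]] := subgraph_graph GV Gf; rewrite GT in fV eG.
  exists f => //; split; first by split=> // x; apply: fV.
  by move: Gj; rewrite -eG card_components ?setIT => [/eqP||].
split=> //; last by rewrite card_components ?setIT ?fj.
  by apply: graph_subgraph => // x _; apply: fV.
exact: graph_forest.
Qed.

Lemma weight_graphT f : weight v (graph setT f) = cost v 0 f.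
Proof. by rewrite weight_graph; apply: eq_bigl => x; rewrite inE. Qed.

Lemma min_forestsP j G : reflect
  (exists2 f, minimal V v j f & G = graph setT f) (G \in min_forests V v j).
Proof.
apply: (iffP (minimizersP _ _ _)) => [[/forestsP[f [fv fj] ->] minG]|[f [fv fj minf] ->]].
  exists f => //; split=> // g gv gj; rewrite -!weight_graphT.
  by apply: minG; apply/forestsP; exists g.
split; first by apply/forestsP; exists f.
by move=> H /forestsP[g [gv gj] ->]; rewrite !weight_graphT minf.
Qed.

Lemma phi_minimal j f : minimal V v j f -> phi V v j = (cost v 0 f)%:E.
Proof.
move=> fmin; have : graph setT f \in min_forests V v j by apply/min_forestsP; exists f.
by rewrite inE => /andP[_ /eqP eq_w]; rewrite /phi -eq_w weight_graphT.
Qed.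

Lemma phi_cases j : phi V v j = +oo%E \/ exists f, minimal V v j f.
Proof.
have [S0|[G GS]] := set_0Vmem (forests V j).
  by left; rewrite /phi S0 /min_weight big_set0.
right; case: (arg_minP (weight v) GS) => H HS minH.
have /min_forestsP[f fmin _] : H \in min_forests V v j by apply/minimizersP.
by exists f.
Qed.

Lemma phi_le j f : valid V f -> #|fixpts f| = j -> (phi V v j <= (cost v 0 f)%:E)%E.
Proof.
move=> fv fj; rewrite -weight_graphT; apply: bigmin_le_cond.
by apply/forestsP; exists f.
Qed.

Lemma treesP D G : reflect
  (exists f, [/\ acyclic_map f, forall x, x \in D -> f x \in D,
    forall x, x \in D -> f x != x -> (x, f x) \in arcs V,
    #|fixpts f :&: D| = 1%N & G = graph D f])
  (G \in trees_in V D).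
Proof.
rewrite inE; apply: (iffP and3P) => [[GV /andP[Gf Gc] /eqP GD]|[f [acf fD fV f1 ->]]].
  have [f [acf fD fV eG]] := subgraph_graph GV Gf.
  rewrite GD in fD fV eG; exists f; split=> //.
  by move: Gc; rewrite -eG card_components // => /eqP.
split=> //; first exact: graph_subgraph.
by rewrite /is_tree graph_forest // card_components ?f1.
Qed.

End Bridge.

(** * What being an atom means for the minimal maps with [k] roots *)

Section AtomBridge.
Variables (R : realFieldType) (N : finType) (V : digraph N) (v : N * N -> R).
Hypothesis spanning_V : vset V = [set: N].
Hypothesis loopless_V : forall x : N, ~~ has_arc V x x.
Variables (k : nat) (Z : {set N}).

Lemma component_in_algebra f x : minimal V v k f -> tree_of f x \in forest_algebra V v k.
Proof.
move=> fmin; have acf : acyclic_map f by case: fmin => -[].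
apply/bigcapP => A /andP[_ /subsetP]; apply.
apply/bigcupP; exists (graph setT f); first by apply/min_forestsP => //; exists f.
apply/imsetP; exists (induced (graph setT f) (setT :&: tree_of f x)).
  by rewrite componentsE //; apply: imset_f.
by rewrite vset_component setTI.
Qed.

Hypothesis Z_atom : Z \in forest_atoms V v k.

(** The tree of [z] belongs to the algebra and meets [Z], hence contains it. *)
Lemma atom_connected f y z : minimal V v k f -> y \in Z -> z \in Z -> rt f y = rt f z.
Proof.
move=> fmin yZ zZ; move: Z_atom; rewrite inE => /and3P[_ _ /forall_inP/(_ _ (component_in_algebra z fmin))].
case/orP=> /eqP ZC; last by move: yZ; rewrite -ZC inE => /andP[_]; rewrite inE => /eqP.
by have := in_set0 z; rewrite -ZC !inE zZ eqxx.
Qed.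

(* The sets not separating u from z form an algebra; if every generator were  *)
(* one of them, so would be Z.                                                *)
Lemma atom_separated u z : u \notin Z -> z \in Z ->
  exists2 f, minimal V v k f & rt f u <> rt f z.
Proof.
move=> uZ zZ; move: Z_atom; rewrite inE => /and3P[ZA _ _].
have gensP B : B \in \bigcup_(F in min_forests V v k) [set vset T | T in components F] ->
    exists f y, [/\ minimal V v k f, acyclic_map f & B = tree_of f y].
  case/bigcupP=> F /min_forestsP[] // f fmin ->.
  have acf : acyclic_map f by case: fmin => -[].
  case/imsetP=> T; rewrite componentsE // => /imsetP[y _ ->] ->.
  by exists f, y; rewrite vset_component setTI.
have [/exists_inP[B /gensP[f [y [fmin _ ->]]] sep]|/exists_inPn nosep] := boolP
  [exists B in \bigcup_(F in min_forests V v k) [set vset T | T in components F],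
     (u \in B) != (z \in B)].
  by exists f => // eq_rt; rewrite !inE eq_rt eqxx in sep.
pose A : {set {set N}} := [set B : {set N} | (u \in B) == (z \in B)].
have : Z \in A; last by rewrite inE zZ (negPf uZ).
apply: (bigcapP ZA); apply/andP; split.
  apply/and3P; split; first by rewrite !inE.
    by apply/forall_inP=> B; rewrite !inE => /eqP->.
  apply/forall_inP=> B; rewrite !inE => /eqP BA; apply/forall_inP=> B'.
  by rewrite !inE BA => /eqP->.
by apply/subsetP=> B /nosep; rewrite negbK inE.
Qed.

End AtomBridge.

Lemma labeled_root (R : realFieldType) (N : finType) (V : digraph N) (v : N * N -> R)
    (k : nat) (Z : {set N}) :
  vset V = [set: N] -> (forall x : N, ~~ has_arc V x x) ->
  Z \in labeled_atoms V v k ->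
  exists f x, [/\ minimal V v k f, x \in Z & f x = x].
Proof.
move=> spanV loopV; rewrite inE => /andP[_ /exists_inP[F /min_forestsP[] // f fmin ->]].
have acf : acyclic_map f by case: fmin => -[].
case/exists_inP=> T; rewrite componentsE // => /imsetP[y _ ->] /exists_inP[x xZ].
case/andP; rewrite vset_component setTI => xy /forallP/(_ (f x)) nofx.
(* A root of a component is a root of the whole forest, since [f x] lies in the component of [x]. *)
exists f, x; split=> //; apply: contraNeq nofx => nfx.
rewrite /has_arc /= !inE /= nfx eqxx /= rt_step //.
by move: xy; rewrite !inE => ->.
Qed.

(** * The part of an optimal forest on [Z] is a minimal tree *)

Section Trees.
Variables (R : realFieldType) (N : finType) (V : digraph N) (v : N * N -> R).
Hypothesis spanning_V : vset V = [set: N].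
Hypothesis loopless_V : forall x : N, ~~ has_arc V x x.
Variables (lam : R) (m k : nat) (Z : {set N}).
Hypothesis optimal_card : forall f, optimal V v lam f -> (m <= #|fixpts f| <= k)%N.
Hypothesis top_conn : forall f y z, top V v lam k f -> y \in Z -> z \in Z -> rt f y = rt f z.
Variables (K : N -> N) (x : N).
Hypotheses (Ktop : top V v lam k K) (Kx : K x = x) (KZ : tree_of K x = Z).

(** The only root of [T] is not in [Z], so it is the additional vertex, which contributes nothing to
    the weight. *)
Lemma trees_out_map T : T \in trees_out V Z ->
  exists t, [/\ acyclic_map t, forall u, u \in Z -> t u != u -> (u, t u) \in arcs V,
    #|fixpts t :&: Z| = 0%N &
    weight v T = \sum_(u in Z) step_cost v 0 u (t u)].
Proof.
rewrite inE => /and5P[TV /andP[Tf Tc] /eqP cT ZT /andP[_ /forall_inP noroot]].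
have [t [act tD tV eT]] := subgraph_graph loopless_V TV Tf.
have t1 : #|fixpts t :&: vset T| = 1%N.
  by rewrite -card_components // eT; apply/eqP.
have tZ0 : fixpts t :&: Z = set0.
  apply/setP=> u; rewrite !inE; apply/negbTE/andP=> -[/eqP tu uZ].
  have /negP[] := noroot u uZ; rewrite /is_root (subsetP ZT) //=.
  by apply/forallP=> y; rewrite -eT has_arc_graph tu; case: eqP; rewrite ?andbF.
exists t; split=> //; first by move=> u /(subsetP ZT); apply: tV.
  by rewrite tZ0 cards0.
rewrite -[in LHS]eT weight_graph (big_setID Z) /= (setIidPr ZT) [X in _ + X]big1 ?addr0 //.
move=> u uT; have /eqP : fixpts t :&: vset T == vset T :\: Z.
  rewrite eqEcard t1 cardsD (setIidPr ZT) cT subSnn leqnn andbT.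
  apply/subsetP=> w; rewrite !inE => /andP[tw ->]; rewrite andbT.
  by apply/negP=> wZ; have := in_set0 w; rewrite -tZ0 !inE tw wZ.
by move/setP/(_ u); rewrite uT !inE => /andP[tu _]; rewrite /step_cost tu.
Qed.

Variable E : N -> N.
Hypothesis Eo : optimal V v lam E.

Let e := exit Z x E.
Let acE : acyclic_map E. Proof. by case: Eo.1. Qed.
Let eZ : e \in Z. Proof. exact: (exit_in KZ). Qed.
Let exitE u : u \in Z -> (confine Z E u == u) = (u == e).
Proof. exact: (confine_exitE optimal_card top_conn Ktop Kx KZ). Qed.

(** Uniqueness of the exit says that [confine Z E] has exactly one root in [Z]. *)
Lemma induced_tree : induced (graph setT E) Z \in trees_in V Z.
Proof.
rewrite induced_graph; apply/treesP => //; exists (confine Z E); split=> //.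
- exact: acyclic_confine.
- by move=> u; apply: confine_closed.
- move=> u _; rewrite /confine; case: ifP => [_|]; last by rewrite eqxx.
  by case: Eo.1 => _; apply.
- rewrite -(cards1 e); apply: eq_card=> u; rewrite !inE.
  case: (boolP (u \in Z)) => uZ; first by rewrite andbT exitE.
  by rewrite andbF; apply/esym; apply: contraNF uZ => /eqP->.
Qed.

Section Leaving.
Hypothesis leave : exists2 z, z \in Z & E z \notin Z.

Let Ee : E e \notin Z.
Proof.
case: leave => z zZ Ez; have -> // : e = z.
by rewrite [RHS](leaves_exit optimal_card top_conn Ktop Kx KZ Eo zZ Ez).
Qed.

Let fixZ : #|fixpts E :&: Z| = 0%N.
Proof.
apply/eqP; rewrite cards_eq0; apply/eqP/setP=> u; rewrite !inE.
apply/negbTE/andP=> -[Eu uZ].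
have := exitE uZ; rewrite confine_exit // Eu /= => /esym/eqP ue.
by move: Ee; rewrite -ue (eqP Eu) uZ.
Qed.

Let NoutE : Nout Z (graph setT E) = [set E e].
Proof.
apply/setP=> j; rewrite !inE; apply/andP/eqP=> [[jZ /exists_inP[u uZ]]|->].
  rewrite has_arc_graph => /and3P[_ _ /eqP eju]; rewrite eju in jZ *; congr E.
  exact: (leaves_exit optimal_card top_conn Ktop Kx KZ Eo uZ jZ).
split=> //; apply/exists_inP; exists e => //; rewrite has_arc_graph inE eqxx andbT /=.
by apply: contraNneq Ee => ->.
Qed.

Let out u : N := if u \in Z then E u else u.

(** The exit [e] is the only tail of a leaving arc, so [E e] is the one vertex added to [Z], and it
    is the root. *)
Lemma outres_tree : outres (graph setT E) Z \in trees_out V Z.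
Proof.
have [_ EV] := Eo.1.
have acout : acyclic_map out.
  by case: acE => r rP; exists r => u; rewrite /out; case: ifP; rewrite ?eqxx // => _; apply: rP.
have outD u : u \in Z :|: [set E e] -> out u \in Z :|: [set E e].
  rewrite /out; case: ifP => // uZ _; rewrite !inE.
  have [//|EuZ] /= := boolP (E u \in Z).
  by rewrite (leaves_exit optimal_card top_conn Ktop Kx KZ Eo uZ EuZ) eqxx.
rewrite outres_graph NoutE -/out.
have fixout : fixpts out :&: (Z :|: [set E e]) = [set E e].
  apply/setP=> u; rewrite !inE /out; case: (boolP (u \in Z)) => [uZ|uZ]; last by rewrite eqxx.
  have -> : (u == E e) = false by apply: contraNF Ee => /eqP<-.
  by rewrite andbT; apply/negbTE/negP=> Eu; have := card0_eq fixZ u; rewrite !inE Eu uZ.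
rewrite inE; apply/and5P; split.
- by apply: graph_subgraph => // u _; rewrite /out; case: ifP; rewrite ?eqxx // => _; apply: EV.
- by rewrite /is_tree graph_forest // card_components // fixout cards1.
- by rewrite /= setUC cardsU1 Ee.
- exact: subsetUl.
apply/andP; split.
  suff -> : induced (graph (Z :|: [set E e]) out) Z = induced (graph setT E) Z.
    exact: induced_tree.
  congr pair; first by rewrite /= setTI setUK.
  apply/setP=> -[a b]; rewrite !inE /= /out.
  by case: (boolP (a \in Z)) => aZ; rewrite ?andbF.
apply/forall_inP=> u uZ; apply/negP=> /andP[_ /forallP/(_ (E u))].
rewrite has_arc_graph !inE uZ /out uZ eqxx andbT /= negbK => Eu.
by have := card0_eq fixZ u; rewrite !inE Eu uZ.
Qed.

Lemma outres_min_tree : outres (graph setT E) Z \in min_trees_out V v Z.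
Proof.
apply/minimizersP; split; first exact: outres_tree.
move=> T /trees_out_map[t [act tV t0 ->]].
rewrite outres_graph NoutE weight_graph setUC big_setU1 //=.
rewrite (negPf Ee) {1}/step_cost eqxx add0r.
have -> : \sum_(u in Z) step_cost v 0 u (if u \in Z then E u else u) =
          \sum_(u in Z) step_cost v 0 u (E u).
  by apply: eq_bigr => u ->.
by apply: (plug_cost Ktop KZ Eo) => //; [apply: (plug_valid Ktop KZ)|rewrite fixZ t0].
Qed.

End Leaving.

Section Staying.
Hypothesis stay : forall z, z \in Z -> E z \in Z.

Let confE : {in Z, confine Z E =1 E}.
Proof. by move=> u uZ; rewrite /confine stay. Qed.

Let fixZ : #|fixpts E :&: Z| = 1%N.
Proof.
have /treesP[] // := induced_tree => f [_ fZ _ f1]; rewrite induced_graph => efE.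
rewrite -(cards1 e); apply: eq_card => u; rewrite !inE.
case: (boolP (u \in Z)) => uZ; first by rewrite andbT -confE // exitE.
by rewrite andbF; apply/esym; apply: contraNF uZ => /eqP->.
Qed.

Lemma induced_min_tree : induced (graph setT E) Z \in min_trees_in V v Z.
Proof.
apply/minimizersP; split; first exact: induced_tree.
move=> T /treesP[] // t [act tZ tV t1 ->].
rewrite induced_graph (eq_graph confE) !weight_graph.
by apply: (plug_cost Ktop KZ Eo) => //; [apply: (plug_valid Ktop KZ)|rewrite fixZ t1].
Qed.

(** Here [t] is plugged into [E] itself rather than [K], to keep the number of roots of [E]. The
    result is acyclic because [t] stays in [Z], and it costs at most as much as [E] because [E] also
    induces a tree on [Z]. *)
Lemma splice_min_tree T : T \in min_trees_in V v Z ->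
  exists Q, [/\ optimal V v lam Q, #|fixpts Q| = #|fixpts E|,
    outres (graph setT Q) Z = T & induced (graph setT Q) Z = T].
Proof.
case/minimizersP=> /treesP[] // t [act tZ tV t1 ->] minT.
have := minT _ induced_tree; rewrite induced_graph (eq_graph confE) !weight_graph => le_t.
have cardQ : #|fixpts (splice Z t E)| = #|fixpts E|.
  by rewrite card_fixpts_splice t1 -(cardsID Z (fixpts E)) fixZ.
exists (splice Z t E).
have spZ : {in Z, splice Z t E =1 t} by move=> u uZ; rewrite /splice uZ.
have Qv : valid V (splice Z t E).
  split; first by apply: acyclic_spliceO; case: Eo.1.
  by move=> u; rewrite /splice; case: ifP => [|_]; [exact: tV|have [_] := Eo.1; apply].
split=> //.
- split=> // g /(Eo.2 g); apply: le_trans.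
  rewrite !(cost_fixpts _ lam) cardQ lerD2r /cost.
  rewrite (bigID (mem Z)) [leRHS](bigID (mem Z)) /=.
  apply: lerD; first by rewrite (eq_bigr (fun u => step_cost v 0 u (t u))) // => u uZ; rewrite spZ.
  by apply: ler_sum => u uZ; rewrite /splice (negPf uZ).
- have NZ : Nout Z (graph setT (splice Z t E)) = set0.
    by apply/eqP; apply/negPn/negP=> /Nout_graph[z zZ]; rewrite spZ ?tZ.
  rewrite outres_graph NZ setU0; apply: eq_graph => u uZ /=.
  by rewrite uZ spZ.
rewrite induced_graph; apply: eq_graph => u uZ.
by rewrite /confine spZ // tZ.
Qed.

End Staying.
End Trees.

(** * The charge [lam] and the constant [C] from the gaps of [phi] *)

Section LevelCosts.
Variables (R : realFieldType) (N : finType) (V : digraph N) (v : N * N -> R).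
Hypothesis spanning_V : vset V = [set: N].
Hypothesis loopless_V : forall x : N, ~~ has_arc V x x.
Variables (m k : nat).
Hypothesis m_ge1 : (1 <= m)%N.
Hypothesis lt_mk : (m < k)%N.
Hypothesis gap_m : (phi V v m - phi V v m.+1 < phi V v m.-1 - phi V v m)%E.
Hypothesis gaps_eq : forall j : nat, (m <= j < k)%N ->
       (phi V v j - phi V v j.+1 = phi V v m - phi V v m.+1)%E.
Hypothesis gap_k : (phi V v k - phi V v k.+1 < phi V v k.-1 - phi V v k)%E.

Lemma level_costs f g : minimal V v k f -> minimal V v k.-1 g ->
  exists lam C, [/\ forall j, (m <= j <= k)%N -> exists2 h, minimal V v j h & cost v lam h = C,
    forall h, valid V h -> #|fixpts h| = m.-1 -> C < cost v lam h &
    forall h, valid V h -> #|fixpts h| = k.+1 -> C < cost v lam h].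
Proof.
move=> fmin gmin; pose lam := cost v 0 g - cost v 0 f.
have phik := phi_minimal spanning_V loopless_V fmin.
have phik1 := phi_minimal spanning_V loopless_V gmin.
have gap j : (m <= j < k)%N -> (phi V v j - phi V v j.+1 = lam%:E)%E.
  move=> /gaps_eq->; rewrite -(@gaps_eq k.-1); last by lia.
  by rewrite prednK ?phik ?phik1 // (leq_ltn_trans _ lt_mk).
(* Descending from [k]: an infinite value of [phi] at the next level would make the gap infinite
   instead of [lam], so a minimal map exists there, with the same charged cost. *)
have level i : (i <= k - m)%N -> exists2 h, minimal V v (k - i) h & cost v lam h = cost v lam f.
  elim: i => [|i IH] le_i; first by exists f; rewrite ?subn0.
  have [|h hmin hC] := IH; first exact: ltnW.
  have := gap (k - i.+1)%N ltac:(lia).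
  have -> : (k - i.+1).+1 = (k - i)%N by lia.
  rewrite (phi_minimal spanning_V loopless_V hmin).
  have [->//|[h' h'min]] := phi_cases v spanning_V loopless_V (k - i.+1).
  rewrite (phi_minimal spanning_V loopless_V h'min) -EFinB => -[eq_lam].
  exists h' => //; rewrite -hC !(cost_fixpts _ lam).
  case: hmin => _ -> _; case: h'min => _ -> _.
  have -> : (k - i)%N = (k - i.+1).+1 by lia.
  by rewrite mulrSr -eq_lam; ring.
exists lam, (cost v lam f); split.
- move=> j jmk; have [|h hmin hC] := level (k - j)%N; first by lia.
  by exists h => //; move: hmin; rewrite subKn //; case/andP: jmk.
- move=> h hv hm; have [|h0 h0min <-] := level (k - m)%N; first by [].
  have h0m : minimal V v m h0 by move: h0min; rewrite subKn // ltnW.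
  have := gap_m; rewrite gap ?leqnn // (phi_minimal spanning_V loopless_V h0m).
  have := phi_le v spanning_V loopless_V hv hm.
  (* The value at [m - 1] may be infinite, but not when a map [h] with that many roots exists. *)
  have [->//|[h' h'min]] := phi_cases v spanning_V loopless_V m.-1.
  rewrite (phi_minimal spanning_V loopless_V h'min) -EFinB lee_fin lte_fin => le_h lt_h.
  rewrite !(cost_fixpts _ lam) hm; case: h0m => _ -> _.
  by rewrite -[in X in X < _](prednK m_ge1) mulrSr; lra.
move=> h hv hk; have := gap_k; have := phi_le v spanning_V loopless_V hv hk.
have [->//|[h' h'min]] := phi_cases v spanning_V loopless_V k.+1.
rewrite phik phik1 (phi_minimal spanning_V loopless_V h'min) -!EFinB lee_fin lte_fin.
rewrite -/lam => le_h lt_h.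
rewrite !(cost_fixpts _ lam) hk; case: fmin => _ -> _.
by rewrite mulrSr; lra.
Qed.

End LevelCosts.

Theorem theorem11 (R : realFieldType) (N : finType) (V : digraph N)
    (v : N * N -> R) (m k : nat) (Z : {set N})
    (spanning_V : vset V = [set: N])
    (loopless_V : forall x : N, ~~ has_arc V x x)
    (spanning_tree_V : exists T : digraph N,
       [/\ subgraph T V, vset T = [set: N] & is_tree T])
    (m_ge1 : (1 <= m)%N)
    (k_le : (k <= #|N| - 1)%N)
    (km_gt1 : (1 < k - m)%N)
    (gap_m : (phi V v m - phi V v m.+1 < phi V v m.-1 - phi V v m)%E)
    (gaps_eq : forall j : nat, (m <= j < k)%N ->
       (phi V v j - phi V v j.+1 = phi V v m - phi V v m.+1)%E)
    (gap_k : (phi V v k - phi V v k.+1 < phi V v k.-1 - phi V v k)%E)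
    (Z_labeled : Z \in labeled_atoms V v k)
    (exF : exists2 F, F \in min_forests V v k.-1 & Nout Z F != set0)
    (exG : exists2 G, G \in min_forests V v k.-1 & Nout Z G = set0) :
  [/\ \bigcup_(H in min_forests V v m) Nout Z H != set0,
      (exists H, [/\ H \in min_forests V v m, Nout Z H != set0 &
                     outres H Z \in min_trees_out V v Z]) /\
      ((forall H, H \in min_forests V v m -> Nout Z H != set0) ->
       forall H, H \in min_forests V v m -> outres H Z \in min_trees_out V v Z)
    & forall S, S \in min_forests V v m -> Nout Z S = set0 ->
        induced S Z \in min_trees_in V v Z /\
        (forall T, T \in min_trees_in V v Z ->
           exists Q, [/\ Q \in min_forests V v m, outres Q Z = T &
                         induced Q Z = T])].
Proof.
have lt_mk : (m < k)%N by lia.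
case: exF => _ /min_forestsP[] // F Fmin -> /Nout_graph[z zZ Fz].
have [f [x [fmin xZ fx]]] := labeled_root spanning_V loopless_V Z_labeled.
have Zatom : Z \in forest_atoms V v k by move: Z_labeled; rewrite inE => /andP[].
have [lam [C [levels low high]]] :=
  level_costs spanning_V loopless_V m_ge1 lt_mk gap_m gaps_eq gap_k fmin Fmin.
have le_mk := ltnW lt_mk.
have card_opt := optimal_card le_mk levels low high.
have opt_min := @optimal_minimal _ _ V v lam.
have min_opt := minimal_optimal le_mk levels low high.
have top_conn g y1 y2 : top V v lam k g -> y1 \in Z -> y2 \in Z -> rt g y1 = rt g y2.
  by move=> [go gk]; apply: (atom_connected spanning_V loopless_V Zatom); apply: opt_min.
have min_top g : minimal V v k g -> top V v lam k g.
  by move=> gmin; split; [apply: (min_opt k); rewrite ?le_mk ?leqnn|case: gmin].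
have top_sep u y : u \notin Z -> y \in Z -> exists2 g, top V v lam k g & rt g u <> rt g y.
  move=> uZ yZ; have [g /min_top gt sep] := atom_separated spanning_V loopless_V Zatom uZ yZ.
  by exists g.
have [K [Ktop Kx KZ]] := atom_is_tree card_opt top_conn top_sep (min_top f fmin) xZ fx.
have Fo : optimal V v lam F by apply: (min_opt k.-1) => //; lia.
have min_opt_m g : minimal V v m g -> optimal V v lam g.
  by apply: min_opt; rewrite leqnn.
have outP g : minimal V v m g -> Nout Z (graph setT g) != set0 ->
    outres (graph setT g) Z \in min_trees_out V v Z.
  move=> /min_opt_m go /Nout_graph leave.
  exact: (outres_min_tree spanning_V loopless_V card_opt top_conn Ktop Kx KZ go leave).
have [H0 H0min _] := levels m ltac:(by rewrite leqnn).
have H0m : #|fixpts H0| = m by case: H0min.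
(* The descent to [m] roots starts from the forest [F] of level [k - 1] that leaves [Z], which is
   optimal too. *)
have [G [Go Gm leaveG]] := leaving_minimal card_opt top_conn Ktop Kx KZ Fo (min_opt_m _ H0min) H0m zZ Fz.
have Gmin : minimal V v m G by apply: opt_min.
have GF : graph setT G \in min_forests V v m by apply/min_forestsP => //; exists G.
have GN : Nout Z (graph setT G) != set0 by apply/Nout_graph.
split.
- case/set0Pn: GN => j jG; apply/set0Pn; exists j; apply/bigcupP.
  by exists (graph setT G).
- split; first by exists (graph setT G); rewrite GF GN outP.
  move=> all_out H HF; have := all_out H HF.
  by case/min_forestsP: HF => // g gmin ->; apply: outP.
move=> _ /min_forestsP[] // S Smin -> NS.
have So := min_opt_m _ Smin.
have stay y : y \in Z -> S y \in Z.
  move=> yZ; apply/negPn/negP=> Sy.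
  have : Nout Z (graph setT S) != set0 by apply/Nout_graph; exists y.
  by rewrite NS eqxx.
split; first exact: (induced_min_tree spanning_V loopless_V card_opt top_conn Ktop Kx KZ So stay).
move=> T Tmin.
have [Q [Qo Qc Qout Qin]] :=
  splice_min_tree spanning_V loopless_V card_opt top_conn Ktop Kx KZ So stay Tmin.
exists (graph setT Q); split=> //; apply/min_forestsP => //; exists Q => //.
by apply: opt_min => //; rewrite Qc; case: Smin.
Qed.
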